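(* Let $M=(M_I)_{I\in\mathcal{D}^4}$ be a non-positive sliced dyadic submartingale on $I_0=[0,1)$, and set $\nu=(\nu_I)_{I\in\mathcal{D}^4}$ with $$\nu_I=|I|\,e^{M_I}\,\Delta^{\mathrm{dy}}M_I .$$ Then $\nu$ is Carleson and there is the embedding from $H^2_{\mathrm{dy}}$ to $\ell^2(\nu)$ with constant $1$: for all $f=u+iv\in H^2_{\mathrm{dy}}$, $$\sum_{I\in\mathcal{D}^4}\nu_I\,(u_I^2+v_I^2)\leqslant \|f\|_{H^2_{\mathrm{dy}}}^2 .$$
   Context: Let $I_0=[0,1)$ and let $\mathcal{D}^4=\mathcal{D}^4(I_0)=\{[n4^{-k},(n+1)4^{-k}) : k\in\mathbb{N}_0,\ 0\leqslant n\leqslant 4^k-1\}$ be the 4-adic intervals. For an interval $I$ write $I_-$ and $I_+$ for its left and right halves. For $I\in\mathcal{D}^4$ set $I^y=I_-$ and $I^x=I_+$, and let $I^\star_-$, $I^\star_+$ be the left and right halves of $I^\star$, $\star\in\{x,y\}$; these are the four 4-adic children of $I$, each of length $|I|/4$. A real family $u=(u_I)_{I\in\mathcal{D}^4}$ is a sliced dyadic martingale if for all $I\in\mathcal{D}^4$ $$u_I=\frac{u_{I^x_+}+u_{I^x_-}}2=\frac{u_{I^y_+}+u_{I^y_-}}2 .$$ Its increments are $\Delta^\star u_I=\frac12(u_{I^\star_+}-u_{I^\star_-})$, $\star\in\{x,y\}$. If it is $L^2$ integrable, i.e. $\sup_n\sum_{I\in\mathcal{D}^4,|I|=4^{-n}}|I|u_I^2<\infty$,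 then it is identified with its $L^2$ limit $u\in L^2(I_0)$, so that $u_I=\langle u\rangle_I$ is the average of $u$ over $I$. The dyadic Hardy space $H^2_{\mathrm{dy}}$ consists of $f=u+iv$ with $u,v$ real-valued $L^2$ integrable sliced dyadic martingales satisfying the dyadic Cauchy–Riemann equations $\Delta^x u_I=\Delta^y v_I$, $\Delta^y u_I=-\Delta^x v_I$ for all $I\in\mathcal{D}^4$. Its norm is $\|f\|^2_{H^2_{\mathrm{dy}}}=\int_{I_0}(u^2+v^2)$. A sliced dyadic submartingale is a real family $M=(M_I)_{I\in\mathcal{D}^4}$ such that for all $I\in\mathcal{D}^4$ $$M_I\leqslant\frac{M_{I^x_+}+M_{I^x_-}}2=\frac{M_{I^y_+}+M_{I^y_-}}2 .$$ It is non-positive if $M_I\leqslant0$ for all $I$. Its dyadic Laplacian is $\Delta^{\mathrm{dy}}M_I=\frac12(M_{I^x_+}+M_{I^x_-})-M_I=\frac12(M_{I^y_+}+M_{I^y_-})-M_I\geqslant0$. A non-negative sequence $\nu=(\nu_I)_{I\in\mathcal{D}^4}$ is called Carleson if $H^2_{\mathrm{dy}}$ embeds boundedly in $\ell^2(\nu)$, i.e. there is a finite $C$ with $\sum_{I\in\mathcal{D}^4}\nu_I(u_I^2+v_I^2)\leqslant C\|f\|^2_{H^2_{\mathrm{dy}}}$ for all $f=u+iv\in H^2_{\mathrm{dy}}$. *)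

(* Defs.v *)
From HB Require Import structures.
From mathcomp Require Import all_boot all_order all_algebra.
From mathcomp Require Import all_classical all_reals all_analysis.
From mathcomp Require Import ring.
Import Order.TTheory GRing.Theory Num.Theory.
Import numFieldNormedType.Exports.

Set Implicit Arguments.
Unset Strict Implicit.
Unset Printing Implicit Defensive.

Local Open Scope classical_set_scope.
Local Open Scope ring_scope.

(* The 4-adic interval [n 4^-k, (n+1) 4^-k) is encoded by the pair (k, n);
   distinct pairs give distinct intervals. *)
Definition D4 : Type := {k : nat & 'I_(4 ^ k)}.

Definition mkD4 (k : nat) (n : 'I_(4 ^ k)) : D4 := existT _ k n.

Definition len (R : realType) (I : D4) : R := 4 ^- tag I.

Definition lend (R : realType) (I : D4) : R := (tagged I)%:R * len R I.

Definition itv4 (R : realType) (I : D4) : set R :=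
  [set` `[lend R I, lend R I + len R I[].
Arguments itv4 R I : clear implicits.

Definition I0 (R : realType) : set R := [set` `[0, 1[].
Arguments I0 R : clear implicits.

Inductive slice := sx | sy.

(* I^y is the left half of I and I^x the right half. The children of
   [n 4^-k, (n+1) 4^-k) are, from left to right and with numerators
   4n, 4n+1, 4n+2, 4n+3 over 4^(k+1): I^y_-, I^y_+, I^x_-, I^x_+ .
   The sign is encoded by a boolean: true is +, false is -. *)
Definition quarter (s : slice) (b : bool) : nat :=
  ((if s is sx then 2 else 0) + b)%N.

Lemma child_subproof (I : D4) (s : slice) (b : bool) :
  (4 * tagged I + quarter s b < 4 ^ (tag I).+1)%N.
Proof.
case: I => k n /=; rewrite expnS.
apply: (@leq_trans (4 * n.+1)); last by rewrite leq_mul2l ltn_ord.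
by rewrite mulnS addnC ltn_add2r; case: s; case: b.
Qed.

Definition child (I : D4) (s : slice) (b : bool) : D4 :=
  @mkD4 (tag I).+1 (Ordinal (child_subproof I s b)).

Lemma len_child (R : realType) (I : D4) (s : slice) (b : bool) :
  len R (child I s b) = len R I / 4.
Proof. by rewrite /len /= exprS invfM mulrC. Qed.

Lemma lend_child (R : realType) (I : D4) (s : slice) (b : bool) :
  lend R (child I s b) =
  lend R I + (if s is sx then len R I / 2 else 0)
           + (if b then len R I / 4 else 0).
Proof.
rewrite /lend len_child.
have -> : tagged (child I s b) = (4 * tagged I + quarter s b)%N :> nat by [].
rewrite natrD natrM; move: ((tagged I)%:R) (len R I) => t l.
by case: s; case: b; rewrite /quarter /=; field.
Qed.

Definition slice_mean (R : realType) (u : D4 -> R) (s : slice) (I : D4) : R :=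
  (u (child I s true) + u (child I s false)) / 2.

Definition incr (R : realType) (u : D4 -> R) (s : slice) (I : D4) : R :=
  (u (child I s true) - u (child I s false)) / 2.

Definition sliced_martingale (R : realType) (u : D4 -> R) : Prop :=
  forall I, u I = slice_mean u sx I /\ slice_mean u sx I = slice_mean u sy I.

Definition L2_integrable (R : realType) (u : D4 -> R) : Prop :=
  (ereal_sup [set (\sum_(i < 4 ^ n) len R (mkD4 i) * u (mkD4 i) ^+ 2)%:E
             | n in [set: nat]] < +oo)%E.

Definition gen (R : realType) (u : D4 -> R) (n : nat) (x : R) : R :=
  \sum_(i < 4 ^ n) u (mkD4 i) * \1_(itv4 R (mkD4 i)) x.

Definition sqint (R : realType) (g : R -> R) : \bar R :=
  (\int[lebesgue_measure]_(x in I0 R) (g x ^+ 2)%:E)%E.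

Definition L2_limit (R : realType) (u : D4 -> R) (U : R -> R) : Prop :=
  [/\ measurable_fun (I0 R) U,
      (sqint U < +oo)%E &
      sqint (fun x => U x - gen u n x) @[n --> \oo] --> 0%E].

Definition dyadic_CR (R : realType) (u v : D4 -> R) : Prop :=
  forall I, incr u sx I = incr v sy I /\ incr u sy I = - incr v sx I.

(* An element f = u + i v of the dyadic Hardy space: the families of averages
   (u_I), (v_I), together with representatives on [0, 1) of the L^2 limits
   with which they are identified. Every L^2 integrable martingale has such a
   limit, unique up to a null set, so carrying it restricts nothing. *)
Record H2dy (R : realType) := {
  re : D4 -> R;
  im : D4 -> R;
  re_lim : R -> R;
  im_lim : R -> R;
  re_martingale : sliced_martingale re;
  im_martingale : sliced_martingale im;
  re_L2_integrable : L2_integrable re;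
  im_L2_integrable : L2_integrable im;
  H2dy_CR : dyadic_CR re im;
  re_limP : L2_limit re re_lim;
  im_limP : L2_limit im im_lim }.

Definition H2dy_norm2 (R : realType) (f : H2dy R) : \bar R :=
  (\int[lebesgue_measure]_(x in I0 R)
     (re_lim f x ^+ 2 + im_lim f x ^+ 2)%:E)%E.

Definition l2_norm2 (R : realType) (nu : D4 -> R) (f : H2dy R) : \bar R :=
  (\esum_(I in [set: D4]) (nu I * (re f I ^+ 2 + im f I ^+ 2))%:E)%E.

Definition Carleson (R : realType) (nu : D4 -> R) : Prop :=
  (forall I, 0 <= nu I) /\
  exists C : R, forall f : H2dy R, (l2_norm2 nu f <= C%:E * H2dy_norm2 f)%E.

Definition sliced_submartingale (R : realType) (M : D4 -> R) : Prop :=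
  forall I, M I <= slice_mean M sx I /\ slice_mean M sx I = slice_mean M sy I.

Definition laplacian (R : realType) (M : D4 -> R) (I : D4) : R :=
  slice_mean M sx I - M I.

(* Main.v *)
Require Import Defs.
From mathcomp Require Import all_boot all_order all_algebra.
From mathcomp Require Import all_classical all_reals all_analysis.
From mathcomp Require Import measurable_realfun ring lra.
Import Order.TTheory GRing.Theory Num.Theory.
Local Open Scope ring_scope.

(** The proof is a Bellman function argument. Put
    [B I = exp (M I) * (u I ^+ 2 + v I ^+ 2)]. The claim is that, on each
    interval [I], the mean of [B] over the four children exceeds [B I] by at
    least [exp (M I) * laplacian M I * (u I ^+ 2 + v I ^+ 2)]; this is
    [bellman_step]. Write [f = u + i v] and [M = m] at [I], let [d] be the
    Laplacian of [M] at [I] and [s], [t] its increments on the slices x and y.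
    By the Cauchy-Riemann equations the values of [f] on the children are
    [f + w], [f - w] on the slice x and [f + i w], [f - i w] on the slice y,
    for one complex number [w], while those of [M] are [m + d + s],
    [m + d - s] and [m + d + t], [m + d - t]. Since [exp d >= 1 + d], it is
    enough to treat [m = d = 0], where the inequality says that
      [(|f|^2 + |w|^2) (cosh s + cosh t) / 2 + X sinh s + Y sinh t >= |f|^2]
    as soon as [X^2 + Y^2 = |f|^2 |w|^2] ([bellman_quadratic]).

    Multiplying by the length of [I] and summing over the generations below
    [n], the increments of [B] telescope ([bellman_telescope]): the partial sum
    of the series in the theorem is at most the sum of [len I * B I] over
    generation [n], hence, as [M <= 0], at most the sum of
    [len I * (u I ^+ 2 + v I ^+ 2)], which is the squared L2 norm of the
    [n]-th step functions of [u] and [v] ([sqint_gen]). These norms increase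
    with [n] and so are bounded by the norm of the limit
    ([level_sum_sqr_le_sqint]). *)

Set Implicit Arguments.
Unset Strict Implicit.
Unset Printing Implicit Defensive.

(** * Sums over the intervals of a generation *)

Definition level_sum (R : realType) (phi : D4 -> R) (n : nat) : R :=
  \sum_(i < 4 ^ n) len R (mkD4 i) * phi (mkD4 i).

Definition children_mean (R : realType) (phi : D4 -> R) (I : D4) : R :=
  (slice_mean phi sx I + slice_mean phi sy I) / 2.

Lemma len_ge0 (R : realType) (I : D4) : 0 <= len R I.
Proof. by rewrite /len invr_ge0 exprn_ge0. Qed.

Lemma ler_level_sum (R : realType) (phi psi : D4 -> R) (n : nat) :
  (forall I, phi I <= psi I) -> level_sum phi n <= level_sum psi n.
Proof.
by move=> le_phi_psi; apply: ler_sum => i _; rewrite ler_wpM2l ?len_ge0.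
Qed.

Lemma level_sumD (R : realType) (phi psi : D4 -> R) (n : nat) :
  level_sum (fun I => phi I + psi I) n = level_sum phi n + level_sum psi n.
Proof. by rewrite -big_split; apply: eq_bigr => i _; rewrite mulrDr. Qed.

Lemma sum_ord_mul4 (R : realType) (g : nat -> R) (m N : nat) :
  N = (m * 4)%N ->
  \sum_(i < N) g i =
  \sum_(i < m) (g (4 * i)%N + g (4 * i + 1)%N + g (4 * i + 2)%N
                + g (4 * i + 3)%N).
Proof.
move=> ->; elim: m => [|m IH]; first by rewrite !big_ord0.
rewrite mulSnr !addnS addn0 !big_ord_recr /= IH !addrA mulnC.
by rewrite addn1 addn2 addn3.
Qed.

(** The children of the [i]-th interval of generation [n] are the intervals
    [4 * i + k], [k < 4], of the next one, each of a quarter of the length. *)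
Lemma level_sumS (R : realType) (phi : D4 -> R) (n : nat) :
  level_sum phi n.+1 = level_sum (children_mean phi) n.
Proof.
(* Extending [phi] to all natural numerators frees the reindexing from the
   dependency of the index type on the generation. *)
pose g k : R := if insub k is Some j then phi (@mkD4 n.+1 j) else 0.
have gE (j : 'I_(4 ^ n.+1)) : g (val j) = phi (mkD4 j) by rewrite /g valK.
transitivity (\sum_(j < 4 ^ n.+1) 4 ^- n.+1 * g j).
  by apply: eq_bigr => j _; rewrite gE.
rewrite (@sum_ord_mul4 _ (fun j => 4 ^- n.+1 * g j) (4 ^ n)) ?expnSr//.
apply: eq_bigr => i _.
have gC s b : g (4 * i + quarter s b)%N = phi (child (mkD4 i) s b).
  exact: (gE (tagged (child (mkD4 i) s b))).
(* The first summand lacks the offset 0 of the slice y, sign -. *)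
rewrite -[X in g X]addn0 (gC sy false) (gC sy true) (gC sx false) (gC sx true).
rewrite /children_mean /slice_mean /len /= exprS invfM.
by field.
Qed.

(** * The Bellman function *)

(** The Bellman inequality for [M] with zero Laplacian. Read [F = |f|^2],
    [W = |w|^2], [(c, s)] and [(c', s')] as (cosh, sinh) of the increments of
    [M], and [X], [Y] as the real and imaginary parts of the product of [f]
    with the conjugate of [w]. With [A] the mean of [c] and [c'],
    Cauchy-Schwarz bounds [(X s + Y s')^2] by [F W (s^2 + s'^2)], which is at
    most [4 F W A (A - 1)] because [(c - 1) (c' - 1) >= 0]; the AM-GM
    inequality bounds this by [(F (A - 1) + W A)^2]. *)
Lemma bellman_quadratic (R : realType) (F W X Y c c' s s' : R) :
  0 <= F -> 0 <= W -> X ^+ 2 + Y ^+ 2 = F * W ->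
  1 <= c -> 1 <= c' -> c ^+ 2 = s ^+ 2 + 1 -> c' ^+ 2 = s' ^+ 2 + 1 ->
  F <= (F + W) * ((c + c') / 2) + X * s + Y * s'.
Proof.
move=> F0 W0 XY c1 c1' cs cs'.
pose A := (c + c') / 2; have A1 : 1 <= A by rewrite /A; lra.
have sinh_le : s ^+ 2 + s' ^+ 2 <= 4 * A * (A - 1).
  have : 0 <= (c - 1) * (c' - 1) by rewrite mulr_ge0// subr_ge0.
  by rewrite /A; nra.
have amgm : 4 * (F * W) * (A * (A - 1)) <= (F * (A - 1) + W * A) ^+ 2.
  have := sqr_ge0 (F * (A - 1) - W * A); nra.
have cauchy : (X * s + Y * s') ^+ 2 <= (F * W) * (s ^+ 2 + s' ^+ 2).
  by rewrite -XY; have := sqr_ge0 (X * s' - Y * s); nra.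
have FW0 : 0 <= F * W by rewrite mulr_ge0.
have sq_le : (X * s + Y * s') ^+ 2 <= (F * (A - 1) + W * A) ^+ 2.
  apply: (le_trans cauchy); apply: le_trans amgm.
  by have := ler_wpM2l FW0 sinh_le; nra.
have B0 : 0 <= F * (A - 1) + W * A.
  by rewrite addr_ge0// mulr_ge0//; lra.
have lo : - (F * (A - 1) + W * A) <= X * s + Y * s'.
  move: sq_le B0; move: (F * (A - 1) + W * A) (X * s + Y * s') => B Z sq_le B0.
  by rewrite leNgt; apply/negP => lt_Z; nra.
by rewrite -/A; nra.
Qed.

Lemma expR_cosh_sinh (R : realType) (s : R) :
  let c := (expR s + expR (- s)) / 2 in let h := (expR s - expR (- s)) / 2 in
  1 <= c /\ c ^+ 2 = h ^+ 2 + 1.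
Proof.
move=> c h; have : expR s * expR (- s) = 1 by rewrite -expRD subrr expR0.
have := expR_gt0 s; have := expR_gt0 (- s); rewrite /c /h.
move: (expR s) (expR (- s)) => p q q0 p0 pq; split; last first.
  by rewrite -[X in _ = _ + X]pq; field.
have : 1 <= ((p + q) / 2) ^+ 2 by have := sqr_ge0 (p - q); nra.
have t0 : 0 <= (p + q) / 2 by lra.
by move: t0; move: ((p + q) / 2) => t t0 t2; nra.
Qed.

(** One generation of the Bellman argument. Here [(a, b)] is the value of
    [(u, v)]; the Cauchy-Riemann equations make its increment [(p, - q)] on
    the slice x and [(q, p)], its image under multiplication by i, on the
    slice y. This rotation is what makes the cross terms of
    [bellman_quadratic] satisfy [X^2 + Y^2 = F W]. The Laplacian [d] enters
    only through the factor [exp d >= 1 + d]. *)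
Lemma bellman_four_points (R : realType) (a b p q m d s t : R) :
  0 <= d ->
  expR m * (a ^+ 2 + b ^+ 2) + expR m * d * (a ^+ 2 + b ^+ 2)
  <= ((expR (m + d + s) * ((a + p) ^+ 2 + (b - q) ^+ 2)
       + expR (m + d - s) * ((a - p) ^+ 2 + (b + q) ^+ 2)) / 2
      + (expR (m + d + t) * ((a + q) ^+ 2 + (b + p) ^+ 2)
         + expR (m + d - t) * ((a - q) ^+ 2 + (b - p) ^+ 2)) / 2) / 2.
Proof.
move=> d0; rewrite !expRD.
have [c1 cs] := expR_cosh_sinh s; have [c1' cs'] := expR_cosh_sinh t.
have key := @bellman_quadratic R (a ^+ 2 + b ^+ 2) (p ^+ 2 + q ^+ 2)
  (a * p - b * q) (a * q + b * p) _ _ _ _ (addr_ge0 (sqr_ge0 _) (sqr_ge0 _))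
  (addr_ge0 (sqr_ge0 _) (sqr_ge0 _)) ltac:(ring) c1 c1' cs cs'.
have ed := expR_ge1Dx d.
have Em := expR_gt0 m.
move: key ed Em; move: (expR s) (expR (- s)) (expR t) (expR (- t)) (expR d)
  (expR m) => es es' et et' ed em key le_ed em0.
have F0 : 0 <= a ^+ 2 + b ^+ 2 by rewrite addr_ge0 ?sqr_ge0.
apply: (@le_trans _ _ (em * ed * (a ^+ 2 + b ^+ 2))).
  have := ler_wpM2l (mulr_ge0 (ltW em0) F0) le_ed; lra.
have ed0 : 0 <= em * ed by rewrite mulr_ge0 ?ltW//; lra.
apply: (le_trans (ler_wpM2l ed0 key)).
by rewrite le_eqVlt; apply/orP; left; apply/eqP; field.
Qed.

Definition bellman (R : realType) (M u v : D4 -> R) (I : D4) : R :=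
  expR (M I) * (u I ^+ 2 + v I ^+ 2).

Lemma child_sliceE (R : realType) (u : D4 -> R) (s : slice) (b : bool) I :
  u (child I s b)
  = slice_mean u s I + (if b then incr u s I else - incr u s I).
Proof. by rewrite /slice_mean /incr; case: b; field. Qed.

Lemma bellman_step (R : realType) (M u v : D4 -> R) (I : D4) :
  sliced_submartingale M -> sliced_martingale u -> sliced_martingale v ->
  dyadic_CR u v ->
  bellman M u v I + expR (M I) * laplacian M I * (u I ^+ 2 + v I ^+ 2)
    <= children_mean (bellman M u v) I.
Proof.
move=> subM martu martv CR.
have [leM eqM] := subM I; have [u_x u_xy] := martu I.
have [v_x v_xy] := martv I; have [cr1 cr2] := CR I.
have d0 : 0 <= laplacian M I by rewrite subr_ge0.
have := bellman_four_points (u I) (v I) (incr u sx I) (incr u sy I) (M I)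
  (incr M sx I) (incr M sy I) d0.
rewrite /children_mean /bellman 2!{1}/slice_mean !child_sliceE.
rewrite -eqM -u_xy -v_xy -u_x -v_x -cr1.
have -> : incr v sx I = - incr u sy I by rewrite cr2 opprK.
by rewrite opprK [slice_mean M sx I](_ : _ = M I + laplacian M I) // addrC subrK.
Qed.

(** Summing [bellman_step] over generations telescopes; the term of
    generation 0 that remains is nonnegative. *)
Lemma bellman_telescope (R : realType) (M u v : D4 -> R) (n : nat) :
  sliced_submartingale M -> sliced_martingale u -> sliced_martingale v ->
  dyadic_CR u v ->
  \sum_(k < n) level_sum
    (fun I => expR (M I) * laplacian M I * (u I ^+ 2 + v I ^+ 2)) k
  <= level_sum (bellman M u v) n.
Proof.
move=> subM martu martv CR; elim: n => [|n IH].
  rewrite big_ord0 sumr_ge0// => i _; rewrite mulr_ge0 ?len_ge0//.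
  by rewrite mulr_ge0 ?expR_ge0// addr_ge0 ?sqr_ge0.
rewrite big_ord_recr /= level_sumS.
apply: (le_trans (lerD IH (lexx _))); rewrite -level_sumD.
by apply: ler_level_sum => I; exact: bellman_step.
Qed.

(** Convexity of the square: [u I] is the mean of [u] over the four children. *)
Lemma level_sum_sqr_homo (R : realType) (u : D4 -> R) (n m : nat) :
  sliced_martingale u -> (n <= m)%N ->
  level_sum (fun I => u I ^+ 2) n <= level_sum (fun I => u I ^+ 2) m.
Proof.
move=> martu /subnKC <-; elim: (m - n)%N => [|k IH]; first by rewrite addn0.
apply: (le_trans IH); rewrite addnS level_sumS.
apply: ler_level_sum => I; have [-> ] := martu I.
rewrite /children_mean /slice_mean.
move: (u (child I sx true)) (u (child I sx false)) => a b.
move: (u (child I sy true)) (u (child I sy false)) => c d e.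
have := sqr_ge0 (a - b); have := sqr_ge0 (c - d).
have : ((a + b) / 2) ^+ 2 = ((c + d) / 2) ^+ 2 by rewrite e.
nra.
Qed.

(** * L2 norms of the generations *)

Lemma itv4_disjoint (R : realType) (n : nat) (i j : 'I_(4 ^ n)) (x : R) :
  itv4 R (mkD4 i) x -> itv4 R (mkD4 j) x -> i = j.
Proof.
wlog lt_ij : i j / (i < j)%N => [hwlog xi xj|].
  case: (ltngtP i j) => [h|h|/val_inj//]; first exact: hwlog xi xj.
  by apply/esym; exact: hwlog xj xi.
rewrite /itv4 /= !in_itv /= /lend /= => /andP[_ x_lt] /andP[le_x _].
have l0 := len_ge0 R (mkD4 i).
have : (i.+1)%:R * len R (mkD4 i) <= j%:R * len R (mkD4 i).
  by rewrite ler_wpM2r// ler_nat.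
rewrite -natr1 mulrDl mul1r => /le_trans/(_ le_x).
by rewrite leNgt x_lt.
Qed.

Lemma itv4_sub (R : realType) (I : D4) : (itv4 R I `<=` I0 R)%classic.
Proof.
case: I => n i x; rewrite /itv4 /I0 /= !in_itv /= => /andP[le_x x_lt].
have l0 := len_ge0 R (mkD4 i).
apply/andP; split.
  by apply: le_trans le_x; rewrite /lend mulr_ge0.
apply: (lt_le_trans x_lt).
have -> : lend R (mkD4 i) + len R (mkD4 i) = (i.+1)%:R * len R (mkD4 i).
  by rewrite -natr1 mulrDl mul1r.
rewrite /len /= ler_pdivrMr ?exprn_gt0// mul1r -natrX ler_nat.
exact: ltn_ord.
Qed.

Lemma measurable_itv4 (R : realType) (I : D4) : measurable (itv4 R I).
Proof. exact: measurable_itv. Qed.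

Lemma measurable_I0 (R : realType) : measurable (I0 R).
Proof. exact: measurable_itv. Qed.

Lemma lebesgue_measure_itv4 (R : realType) (I : D4) :
  lebesgue_measure (itv4 R I) = (len R I)%:E.
Proof.
rewrite /itv4 lebesgue_measure_itv /= lte_fin.
have l0 : 0 < len R I by rewrite /len invr_gt0 exprn_gt0.
by rewrite ltrDl l0 -EFinB addrAC subrr add0r.
Qed.

Lemma measurable_gen (R : realType) (u : D4 -> R) (n : nat) :
  measurable_fun (I0 R) (gen u n).
Proof.
apply: measurable_sum => i; apply: measurable_funM => //.
exact: measurable_indic (measurable_itv4 _).
Qed.

(** The cross terms vanish, since the intervals of a generation are disjoint. *)
Lemma gen_sqr (R : realType) (u : D4 -> R) (n : nat) (x : R) :
  gen u n x ^+ 2 = \sum_(i < 4 ^ n) u (mkD4 i) ^+ 2 * \1_(itv4 R (mkD4 i)) x.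
Proof.
rewrite /gen expr2 big_distrl /=; apply: eq_bigr => i _.
rewrite (bigD1 i) //= mulrDr big_distrr /= big1 => [|j ji].
  by rewrite addr0 indicE; case: (_ \in _); rewrite ?mulr1 ?mulr0 ?expr2.
rewrite !indicE; case: (boolP (x \in itv4 R (mkD4 i))) => xi; last first.
  by rewrite mulr0 mul0r.
case: (boolP (x \in itv4 R (mkD4 j))) => xj; last by rewrite !mulr0.
by move: ji; rewrite (itv4_disjoint (set_mem xi) (set_mem xj)) eqxx.
Qed.

Lemma sqint_gen (R : realType) (u : D4 -> R) (n : nat) :
  sqint (gen u n) = (level_sum (fun I => u I ^+ 2) n)%:E.
Proof.
rewrite /sqint.
under eq_integral => x _.
  rewrite gen_sqr -sumEFin; under eq_bigr do rewrite EFinM. over.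
have mI := @measurable_I0 R.
rewrite ge0_integral_sum//; last 2 first.
- move=> i; apply: measurable_funeM; apply/measurable_EFinP.
  exact: measurable_indic (measurable_itv4 _).
- by move=> i x _; rewrite mule_ge0 ?lee_fin ?sqr_ge0.
rewrite /level_sum -sumEFin; apply: eq_bigr => i _.
rewrite ge0_integralZl ?lee_fin ?sqr_ge0//; last first.
  apply/measurable_EFinP; exact: measurable_indic (measurable_itv4 _).
rewrite integral_indic//; last exact: measurable_itv4.
rewrite setIidl; last exact: itv4_sub.
by rewrite [X in (_ * X)%E]lebesgue_measure_itv4 -EFinM mulrC.
Qed.

Lemma sqint_ge0 (R : realType) (f : R -> R) : (0 <= sqint f)%E.
Proof. by apply: integral_ge0 => x _; rewrite lee_fin sqr_ge0. Qed.

Lemma measurable_EFin_sqr (R : realType) (f : R -> R) :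
  measurable_fun (I0 R) f ->
  measurable_fun (I0 R) (fun x => (f x ^+ 2)%:E).
Proof. by move=> mf; apply/measurable_EFinP; exact: measurable_funX. Qed.

(** The pointwise Young inequality
    [f^2 <= (1 + e) g^2 + (1 + 1/e) (g - f)^2], which replaces the triangle
    inequality of L2 in passing to the limit. *)
Lemma sqint_perturb (R : realType) (f g : R -> R) (e : R) :
  measurable_fun (I0 R) f -> measurable_fun (I0 R) g -> 0 < e ->
  (sqint f <= (1 + e)%:E * sqint g
              + (1 + e^-1)%:E * sqint (fun x => g x - f x)%R)%E.
Proof.
move=> mf mg e0; have mI := @measurable_I0 R.
have ei0 : 0 < e^-1 by rewrite invr_gt0.
have e10 : 0 <= 1 + e by lra.
have ei10 : 0 <= 1 + e^-1 by lra.
have mgf : measurable_fun (I0 R) (fun x => g x - f x).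
  exact: (@measurable_funB _ _ R _ g f).
rewrite /sqint -!ge0_integralZl//; try by [rewrite lee_fin |
  exact: measurable_EFin_sqr | move=> x _; rewrite lee_fin sqr_ge0].
rewrite -ge0_integralD//; try by [
  apply: measurable_funeM; exact: measurable_EFin_sqr
  | move=> x _; rewrite mule_ge0 ?lee_fin ?sqr_ge0].
apply: ge0_le_integral => //; try by [exact: measurable_EFin_sqr
  | move=> x _; rewrite lee_fin sqr_ge0].
- by apply: emeasurable_funD; apply: measurable_funeM;
    exact: measurable_EFin_sqr.
move=> x _; rewrite -!EFinM -EFinD lee_fin.
set b := g x; set a := f x.
rewrite -subr_ge0.
have -> : (1 + e) * b ^+ 2 + (1 + e^-1) * (b - a) ^+ 2 - a ^+ 2
          = e^-1 * (e * b + (b - a)) ^+ 2.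
  by field; rewrite gt_eqF.
by rewrite mulr_ge0 ?sqr_ge0// ltW.
Qed.

(** The sums of generation [m >= n] dominate that of generation [n], and
    [sqint_perturb] compares them with the norm of the limit, up to an error
    vanishing as [m] grows and then a factor [1 + e] with [e] arbitrary. *)
Lemma level_sum_sqr_le_sqint (R : realType) (u : D4 -> R) (U : R -> R) (n : nat) :
  sliced_martingale u -> L2_limit u U ->
  ((level_sum (fun I => u I ^+ 2) n)%:E <= sqint U)%E.
Proof.
move=> martu [mU finU cvgU].
have r_fin : sqint U \is a fin_num by rewrite ge0_fin_numE ?sqint_ge0.
have bound e : 0 < e ->
    ((level_sum (fun I => u I ^+ 2) n)%:E <= (1 + e)%:E * sqint U)%E.
  move=> e0.
  have cvgR : (((1 + e)%:E * sqint U
      + (1 + e^-1)%:E * sqint (fun x => U x - gen u m x)%R)%E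
      @[m --> \oo] --> ((1 + e)%:E * sqint U)%E)%classic.
    rewrite -[X in (_ --> X)%classic]adde0 -[X in (_ + X)%E](mule0 (1 + e^-1)%:E).
    apply: cvgeD; last by apply: cvgeZl.
    + by rewrite mule0 fin_num_adde_defl.
    + exact: cvg_cst.
  apply: cvge_ge cvgR; near=> m.
  apply: (@le_trans _ _ (sqint (gen u m))).
    rewrite sqint_gen lee_fin; apply: level_sum_sqr_homo => //.
    by near: m; exact: nbhs_infty_ge.
  by apply: sqint_perturb => //; exact: measurable_gen.
have r0 := sqint_ge0 U; move: r0 bound; rewrite -(fineK r_fin) !lee_fin.
move: (fine _) (level_sum _ _) => r L r0; apply: contraPT; rewrite -ltNge.
(* With this [e] the bound reads [L <= r + e r < r + e (r + 1) = L]. *)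
move=> lt_rL; pose e := (L - r) / (r + 1) => /(_ e).
have e0 : 0 < e by rewrite divr_gt0//; lra.
have er : e * (r + 1) = L - r by rewrite mulfVK// gt_eqF//; lra.
move=> /(_ e0); rewrite -EFinM lee_fin; apply/negP; rewrite -ltNge.
nra.
Unshelve. all: by end_near.
Qed.

(** * The embedding *)

Lemma esum_levels (R : realType) (a : D4 -> R) (c : \bar R) :
  (forall I, 0 <= a I) ->
  (forall n, ((\sum_(k < n) \sum_(i < 4 ^ k) a (mkD4 i))%:E <= c)%E) ->
  (\esum_(I in [set: D4]) (a I)%:E <= c)%E.
Proof.
move=> a0 le_c.
have -> : ([set: D4] = \bigcup_n range (@mkD4 n))%classic.
  by apply/seteqP; split=> [[n i] _|//]; exists n => //; exists i.
rewrite nneseries_sum_bigcup => [||I]; last by rewrite lee_fin.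
  apply: lime_le.
    apply: is_cvg_nneseries => n _ _; apply: esum_ge0 => I _.
    by rewrite lee_fin.
  apply: nearW => n; apply: le_trans (le_c n).
  rewrite big_mkord -sumEFin lee_sum// => k _.
  rewrite esum_image; last by move=> i j _ _; apply: eq_from_Tagged.
  rewrite esum_fset; [|exact: finite_finset|by move=> i _; rewrite lee_fin].
  rewrite -sumEFin (fsbigE (index_enum 'I_(4 ^ k))) ?index_enum_uniq//.
    by under eq_bigl do rewrite in_setT.
  by move=> i _; rewrite mem_index_enum.
by move=> i j _ _ [I [[x _ <-] [y _ /(congr1 tag)]]].
Qed.

Theorem lemma2 (R : realType) (M : D4 -> R)
    (M_submartingale : sliced_submartingale M)
    (M_nonpositive : forall I : D4, M I <= 0) :
  let nu : D4 -> R := fun I => len R I * expR (M I) * laplacian M I in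
  Carleson nu /\ forall f : H2dy R, (l2_norm2 nu f <= H2dy_norm2 f)%E.
Proof.
move=> nu.
have nu0 I : 0 <= nu I.
  have [leM _] := M_submartingale I.
  by rewrite !mulr_ge0 ?len_ge0 ?expR_ge0// subr_ge0.
have embed (f : H2dy R) : (l2_norm2 nu f <= H2dy_norm2 f)%E.
  have normE : H2dy_norm2 f = (sqint (re_lim f) + sqint (im_lim f))%E.
    have [mU _ _] := re_limP f; have [mV _ _] := im_limP f.
    rewrite /sqint -ge0_integralD; first by [].
    + exact: measurable_I0.
    + by move=> x _; rewrite lee_fin sqr_ge0.
    + exact: measurable_EFin_sqr.
    + by move=> x _; rewrite lee_fin sqr_ge0.
    + exact: measurable_EFin_sqr.
  apply: esum_levels => [I|n]; first by rewrite mulr_ge0 ?addr_ge0 ?sqr_ge0.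
  rewrite normE.
  have mart_re := re_martingale f; have mart_im := im_martingale f.
  apply: (@le_trans _ _ (level_sum (bellman M (re f) (im f)) n)%:E).
    rewrite lee_fin.
    have := bellman_telescope n M_submartingale mart_re mart_im (H2dy_CR f).
    apply: le_trans; rewrite le_eqVlt; apply/orP; left; apply/eqP.
    by apply: eq_bigr => k _; apply: eq_bigr => i _; rewrite !mulrA.
  apply: (@le_trans _ _
      (level_sum (fun I => re f I ^+ 2 + im f I ^+ 2) n)%:E).
    rewrite lee_fin; apply: ler_level_sum => I.
    rewrite ler_piMl ?addr_ge0 ?sqr_ge0// -expR0 ler_expR.
    exact: M_nonpositive.
  rewrite level_sumD EFinD leeD//.
    exact: level_sum_sqr_le_sqint mart_re (re_limP f).
  exact: level_sum_sqr_le_sqint mart_im (im_limP f).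
split=> //; split=> //.
by exists 1 => f; rewrite mul1e.
Qed.
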